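(* Let $f$ and $g$ be partial multi-valued functions on represented spaces. If $g$ is a cylinder, then the following are equivalent: (1) $f\le_W g'$; (2) $f=g_0\circ l_0$ for some partial multi-valued functions $g_0,l_0$ on represented spaces with $g_0\le_W g$ and $l_0\le_W\lim$. For arbitrary $g$ (not necessarily a cylinder) the following are equivalent: (1') $f\le_{sW}g'$; (2') $f\sqsupseteq g_0\circ l_0$ for some $g_0\le_{sW}g$ and $l_0\le_{sW}\lim$; (2'') $f\le_{sW}g_0\circ l_0$ for some $g_0\le_{sW}g$ and $l_0\le_{sW}\lim$.
   Context: Baire space is $\mathbb{N}^\mathbb{N}$, represented by the identity. A representation of a set $X$ is a surjective partial function $\delta:\subseteq\mathbb{N}^\mathbb{N}\to X$; a represented space is a pair $(X,\delta)$. For a partial multi-valued function $f:\subseteq(X,\delta_X)\rightrightarrows(Y,\delta_Y)$, a realizer is a single-valued partial $F:\subseteq\mathbb{N}^\mathbb{N}\to\mathbb{N}^\mathbb{N}$ with $\delta_Y(F(p))\in f(\delta_X(p))$ for all $p\in\mathrm{dom}(f\circ\delta_X)$; write $F\vdash f$. Let $\langle p,q\rangle(2n)=p(n)$, $\langle p,q\rangle(2n+1)=q(n)$. Weihrauch reducibility: $f\le_W g$ iff there are computable partial $H,K:\subseteq\mathbb{N}^\mathbb{N}\to\mathbb{N}^\mathbb{N}$ such that $p\mapsto H\langle p,G(K(p))\rangle$ is a realizer of $f$ for every $G\vdash g$; strong Weihrauch reducibility $f\le_{sW}g$: there are computable $H,K$ with $H\circ G\circ K\vdash f$ for every $G\vdash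 g$; $\equiv_W,\equiv_{sW}$ denote mutual reducibility. Composition of multi-valued functions: $(g\circ h)(x)=\bigcup_{y\in h(x)}g(y)$ with $\mathrm{dom}(g\circ h)=\{x\in\mathrm{dom}(h):h(x)\subseteq\mathrm{dom}(g)\}$. For $f_1,f_2:\subseteq X\rightrightarrows Y$ write $f_1\sqsupseteq f_2$ if $\mathrm{dom}(f_1)\subseteq\mathrm{dom}(f_2)$ and $f_1(x)\supseteq f_2(x)$ for all $x\in\mathrm{dom}(f_1)$. Product: for $f:\subseteq X\rightrightarrows Y$, $g:\subseteq Z\rightrightarrows W$, $(f\times g)(x,z)=f(x)\times g(z)$, where $X\times Z$ is represented by $\langle p,q\rangle\mapsto(\delta_X(p),\delta_Z(q))$. $g$ is a cylinder if $g\equiv_{sW}\mathrm{id}\times g$ where $\mathrm{id}$ is the identity on Baire space. Let $\langle p_0,p_1,\ldots\rangle(\langle i,j\rangle)=p_i(j)$ for a standard computable pairing $\langle i,j\rangle$ on $\mathbb{N}$. $\lim:\subseteq\mathbb{N}^\mathbb{N}\to\mathbb{N}^\mathbb{N}$ sends $\langle p_0,p_1,\ldots\rangle$ to $\lim_i p_i$ (in Baire space) whenever it exists. The derivative $g'$ of $g:\subseteq(Z,\delta_Z)\rightrightarrows(W,\delta_W)$ is the same multi-valued function with input representation $\delta_Z\circ\lim$ instead of $\delta_Z$. *)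

(* Defs.v *)
From Stdlib Require Cantor.
From mathcomp Require Import all_boot.
From mathcomp Require Import boolp classical_sets.
From mathcomp Require Import topology function_spaces.

Set Implicit Arguments.
Unset Strict Implicit.
Unset Printing Implicit Defensive.

Local Open Scope classical_set_scope.

Definition mfun (A B : Type) : Type := A -> set B.

Definition mdom (A B : Type) (f : mfun A B) : set A := [set x | f x !=set0].

Definition mcomp (A B C : Type) (g : mfun B C) (h : mfun A B) : mfun A C :=
  fun x => [set z | h x `<=` mdom g /\ exists2 y, h x y & g y z].

(* f1 \sqsupseteq f2 *)
Definition mweaker (A B : Type) (f1 f2 : mfun A B) : Prop :=
  mdom f1 `<=` mdom f2 /\ forall x, mdom f1 x -> f2 x `<=` f1 x.

Definition mprod (A B C D : Type) (f : mfun A B) (g : mfun C D) :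
    mfun (A * C) (B * D) :=
  fun u => f u.1 `*` g u.2.

Notation baire := (nat -> nat).

(* A partial function is a multi-valued function F with is_fun F. *)
Notation bfun := (mfun baire baire).

Definition npair (i j : nat) : nat := Cantor.to_nat (i, j).
Definition nfst (n : nat) : nat := (Cantor.of_nat n).1.
Definition nsnd (n : nat) : nat := (Cantor.of_nat n).2.

Definition bpair (p q : baire) : baire :=
  fun n => if odd n then q n./2 else p n./2.

(* r = <p_0, p_1, ...> with p_i := bslice r i, since npair is a bijection. *)
Definition bslice (r : baire) (i : nat) : baire := fun j => r (npair i j).

(* Partial recursive functions relative to an oracle, presented as unary
   functions on nat through the pairing npair. *)
Inductive code : Type :=
| CZero
| CSucc
| CFst
| CSnd
| COracle
| CPair of code & code
| CComp of code & code
| CRec of code & code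
| CMu of code.

(* ceval p e x v : program e with oracle p halts on input x with output v. *)
Fixpoint ceval (p : baire) (e : code) (x v : nat) : Prop :=
  match e with
  | CZero => v = 0
  | CSucc => v = x.+1
  | CFst => v = nfst x
  | CSnd => v = nsnd x
  | COracle => v = p x
  | CPair f g =>
      exists a b, [/\ ceval p f x a, ceval p g x b & v = npair a b]
  | CComp f g => exists2 y, ceval p g x y & ceval p f y v
  | CRec f g =>
      (* s i is the value on (nfst x, i) *)
      exists s : nat -> nat,
        [/\ ceval p f (nfst x) (s 0),
            forall i, i < nsnd x ->
              ceval p g (npair (nfst x) (npair i (s i))) (s i.+1)
          & v = s (nsnd x)]
  | CMu f =>
      ceval p f (npair x v) 0 /\
      forall i, i < v -> exists k, ceval p f (npair x i) k.+1
  end.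

(* The program may also halt outside the domain of F. *)
Definition computable (F : bfun) : Prop :=
  is_fun F /\
  exists e : code, forall p q, F p q -> forall n, ceval p e n (q n).

Record repSpace : Type := RepSpace {
  carrier :> Type;
  repr : mfun baire carrier;
  repr_fun : is_fun repr;
  repr_surj : forall x, exists p, repr p x }.

Definition realizer (X Y : repSpace) (F : bfun) (f : mfun X Y) : Prop :=
  is_fun F /\
  forall p x, repr p x -> mdom f x ->
    exists q y, [/\ F p q, repr q y & f x y].

Definition leW (X Y Z W : repSpace) (f : mfun X Y) (g : mfun Z W) : Prop :=
  exists H K : bfun, [/\ computable H, computable K &
    forall G : bfun, realizer G g ->
      @realizer X Y
        (fun p => [set r | exists2 q, mcomp G K p q & H (bpair p q) r]) f].

Definition lesW (X Y Z W : repSpace) (f : mfun X Y) (g : mfun Z W) : Prop :=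
  exists H K : bfun, [/\ computable H, computable K &
    forall G : bfun, realizer G g -> @realizer X Y (mcomp H (mcomp G K)) f].

Definition equivsW (X Y Z W : repSpace) (f : mfun X Y) (g : mfun Z W) : Prop :=
  lesW f g /\ lesW g f.

Lemma id_repr_fun : is_fun (fun p : baire => [set p]).
Proof. by move=> p q r /= -> ->. Qed.

Lemma id_repr_surj (q : baire) : exists p : baire, [set p] q.
Proof. by exists q. Qed.

Definition baireS : repSpace := RepSpace id_repr_fun id_repr_surj.

Definition idB : mfun baireS baireS := fun p => [set p].

Lemma bpair_inj p q p' q' : bpair p q = bpair p' q' -> p = p' /\ q = q'.
Proof.
move=> E; split; apply: funext => n.
- by have := congr1 (fun r => r n.*2) E; rewrite /bpair odd_double doubleK.
- have := congr1 (fun r => r n.*2.+1) E.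
  by rewrite /bpair /= odd_double uphalf_double.
Qed.

Definition prod_repr (X Z : repSpace) : mfun baire (X * Z) :=
  fun r => [set u | exists p q,
    [/\ r = bpair p q, repr p u.1 & repr q u.2]].

Lemma prod_repr_fun (X Z : repSpace) : is_fun (@prod_repr X Z).
Proof.
move=> r [x z] [x' z'] /= [p [q [-> /= px qz]]].
move=> [p' [q' [/bpair_inj[<- <-] /= px' qz']]].
by rewrite (repr_fun px px') (repr_fun qz qz').
Qed.

Lemma prod_repr_surj (X Z : repSpace) u : exists r, @prod_repr X Z r u.
Proof.
have [p px] := repr_surj u.1; have [q qz] := repr_surj u.2.
by exists (bpair p q), p, q.
Qed.

Definition prodS (X Z : repSpace) : repSpace :=
  RepSpace (@prod_repr_fun X Z) (@prod_repr_surj X Z).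

Definition cylinder (Z W : repSpace) (g : mfun Z W) : Prop :=
  @equivsW Z W (prodS baireS Z) (prodS baireS W) g (mprod idB g).

(* The type nat -> nat itself carries the uniform structure in the library;
   Baire space has the pointwise (product) topology. *)
Definition limB : mfun baireS baireS :=
  fun r => [set q | {ptws, bslice r @ \oo --> q}].

Lemma limBP (r q : baire) :
  limB r q <->
  forall j, exists N, forall i, N <= i -> r (npair i j) = q j.
Proof.
rewrite /limB /=; split.
- move=> /pointwise_cvgP rq j.
  have [|N _ HN] := rq j [set q j]; first by rewrite nbhs_principalE.
  by exists N => i; apply: HN.
- move=> rq; apply/pointwise_cvgP => j A /nbhs_singleton Aq.
  have [N HN] := rq j; exists N => // i Ni.
  by have := HN i Ni; rewrite /= /bslice => ->.
Qed.

Lemma limB_fun : is_fun limB.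
Proof.
move=> r p q /limBP rp /limBP rq; apply: funext => j.
have [N HN] := rp j; have [M HM] := rq j.
by rewrite -(HN (maxn N M)) ?leq_maxl// (HM (maxn N M)) ?leq_maxr.
Qed.

Definition jump_repr (Z : repSpace) : mfun baire Z := mcomp (@repr Z) limB.

Lemma jump_repr_fun (Z : repSpace) : is_fun (@jump_repr Z).
Proof.
move=> r x y [_ [q rq qx]] [_ [q' rq' q'y]].
by move: q'y; rewrite -(limB_fun rq rq'); exact: repr_fun.
Qed.

Lemma jump_repr_surj (Z : repSpace) x : exists r, @jump_repr Z r x.
Proof.
have [p px] := repr_surj x.
pose r : baire := fun n => p (nsnd n).
have rp : limB r p.
  by apply/limBP => j; exists 0 => i _; rewrite /r /nsnd /npair Cantor.cancel_of_to.
exists r; split; last by exists p.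
by move=> q rq; rewrite -(limB_fun rp rq); exists x.
Qed.

Definition jumpS (Z : repSpace) : repSpace :=
  RepSpace (@jump_repr_fun Z) (@jump_repr_surj Z).

(* g' *)
Definition deriv (Z W : repSpace) (g : mfun Z W) : mfun (jumpS Z) W := g.

(* Main.v *)
From Stdlib Require Cantor.
From mathcomp Require Import all_boot.
From mathcomp Require Import boolp classical_sets.
Require Import Defs.

(** A reduction is determined by its two programs: testing it against realizers
    that are defined only where they must be, and take a prescribed value at one
    point, turns "for every realizer" into a pointwise condition on names.
    Programs can moreover be pushed through limits: if [P] is a sequence of
    oracles converging to [q] and the program [e] computes [r] from [q], run [e]
    on the i-th oracle with unbounded searches cut off after [i] steps.  These
    approximations are total and uniformly computable from [P], and since a
    halting computation consults finitely many oracle values they converge to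
    [r].  Hence whatever is computed after taking a limit may be computed before
    it, which turns a composition of a reduction to [lim] with a reduction to
    [g] into a single reduction to [g'].  In the non-strong case the
    postprocessing for [g] also needs the (limit computed) input of [g0], and a
    cylinder [g] can pass it through. *)

Set Implicit Arguments.
Unset Strict Implicit.
Unset Printing Implicit Defensive.

Local Open Scope classical_set_scope.

Lemma nfst_npair i j : nfst (npair i j) = i.
Proof. by rewrite /nfst /npair Cantor.cancel_of_to. Qed.

Lemma nsnd_npair i j : nsnd (npair i j) = j.
Proof. by rewrite /nsnd /npair Cantor.cancel_of_to. Qed.

Lemma npair_fst_snd n : npair (nfst n) (nsnd n) = n.
Proof.
by rewrite /npair /nfst /nsnd -surjective_pairing Cantor.cancel_to_of.
Qed.

(** * Programs *)

Lemma ceval_det p e x v w : ceval p e x v -> ceval p e x w -> v = w.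
Proof.
elim: e x v w => [|||||f IHf g IHg|f IHf g IHg|f IHf g IHg|f IHf] x v w //=;
  try by move=> -> ->.
- move=> [a [b [fa gb ->]]] [a' [b' [fa' gb' ->]]].
  by rewrite (IHf _ _ _ fa fa') (IHg _ _ _ gb gb').
- by move=> [y gy fv] [y' /(IHg _ _ _ gy) <-]; exact: IHf.
- move=> [s [s0 sS ->]] [t [t0 tS ->]].
  have: forall i, i <= nsnd x -> s i = t i.
    elim=> [_|i IHi ix]; first exact: IHf s0 t0.
    by have := tS i ix; rewrite -IHi 1?ltnW// => ti; exact: IHg (sS i ix) ti.
  exact.
- move=> [fv v_lt] [fw w_lt].
  have [vw|wv|//] := ltngtP v w.
  + by have [k /(IHf _ _ _ fv)] := w_lt v vw.
  + by have [k /(IHf _ _ _ fw)] := v_lt w wv.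
Qed.

Definition run (e : code) : bfun := fun p => [set q | forall n, ceval p e n (q n)].

Lemma run_fun e : is_fun (run e).
Proof. by move=> p q r pq pr; apply: funext => n; exact: ceval_det (pq n) (pr n). Qed.

Lemma eq_run e p f f' : run e p f -> f =1 f' -> run e p f'.
Proof. by move=> ef /funext <-. Qed.

Lemma run_computable e : computable (run e).
Proof. by split; [exact: run_fun|exists e]. Qed.

Fixpoint csubst (k e : code) : code :=
  match e with
  | COracle => k
  | CPair f g => CPair (csubst k f) (csubst k g)
  | CComp f g => CComp (csubst k f) (csubst k g)
  | CRec f g => CRec (csubst k f) (csubst k g)
  | CMu f => CMu (csubst k f)
  | _ => e
  end.

(** Replacing every oracle query of [e] by a call to [k] feeds the output of [k] to [e]. All
    compositions of reductions below are built from this. *)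
Lemma run_csubst k e p q r : run k p q -> run e q r -> run (csubst k e) p r.
Proof.
move=> kpq eqr n; have := eqr n; move: n (r n).
elim: {eqr r} e => [|||||f IHf g IHg|f IHf g IHg|f IHf g IHg|f IHf] x v //=.
- by move=> ->; exact: kpq.
- by move=> [a [b [fa gb ->]]]; exists a, b; split; [exact: IHf|exact: IHg|].
- by move=> [y gy fv]; exists y; [exact: IHg|exact: IHf].
- move=> [s [s0 sS ->]]; exists s; split => [|i ix|//]; first exact: IHf.
  by apply: IHg; exact: sS.
- move=> [fv v_lt]; split=> [|i /v_lt[j fj]]; first exact: IHf.
  by exists j; exact: IHf.
Qed.

(** * Basic programs: case distinction, parity, halving, pairing *)

Definition cident : code := CPair CFst CSnd.

Lemma run_cident p : run cident p id.
Proof. by move=> n; exists (nfst n), (nsnd n); rewrite npair_fst_snd. Qed.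

Lemma run_oracle p : run COracle p p.
Proof. by []. Qed.

Lemma run_zero p : run CZero p (fun=> 0).
Proof. by []. Qed.

Lemma run_succ p : run CSucc p S.
Proof. by []. Qed.

Lemma run_fst p : run CFst p nfst.
Proof. by []. Qed.

Lemma run_snd p : run CSnd p nsnd.
Proof. by []. Qed.

Lemma run_pair e e' p f f' : run e p f -> run e' p f' ->
  run (CPair e e') p (fun n => npair (f n) (f' n)).
Proof. by move=> ef ef' n; exists (f n), (f' n). Qed.

Lemma run_comp e e' p f f' : run e p f -> run e' p f' ->
  run (CComp e e') p (f \o f').
Proof. by move=> ef ef' n; exists (f' n). Qed.

Fixpoint prec (f g : nat -> nat) (a n : nat) : nat :=
  if n is m.+1 then g (npair a (npair m (prec f g a m))) else f a.

Lemma run_rec e e' p f g : run e p f -> run e' p g ->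
  run (CRec e e') p (fun n => prec f g (nfst n) (nsnd n)).
Proof.
move=> ef eg n; exists (prec f g (nfst n)); split => // i _ /=; exact: eg.
Qed.

(** A case distinction as a recursion with the condition as counter: the step discards the previous
    value and runs [b] on the parameter. *)
Definition cif (c a b : code) : code :=
  CComp (CRec a (CComp b CFst)) (CPair cident c).

Lemma run_if c a b p fc fa fb : run c p fc -> run a p fa -> run b p fb ->
  run (cif c a b) p (fun n => if fc n is 0 then fa n else fb n).
Proof.
move=> rc ra rb.
apply: eq_run (run_comp (run_rec ra (run_comp rb (@run_fst p)))
  (run_pair (@run_cident p) rc)) _ => n.
rewrite /= nfst_npair nsnd_npair.
by case: (fc n) => [|m] //=; rewrite nfst_npair.
Qed.

(** The step of a recursion receives [npair a (npair i v)]; this extracts the previous value [v]. *)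
Definition clast : code := CComp CSnd CSnd.

Definition codd : code :=
  CComp (CRec CZero (cif clast (CComp CSucc CZero) CZero)) (CPair CZero cident).

Lemma run_odd p : run codd p odd.
Proof.
have rl := run_comp (@run_snd p) (@run_snd p).
apply: eq_run (run_comp (run_rec (@run_zero p)
  (run_if rl (run_comp (@run_succ p) (@run_zero p)) (@run_zero p)))
  (run_pair (@run_zero p) (@run_cident p))) _ => n.
rewrite /= nfst_npair nsnd_npair.
elim: n => //= n ->.
by rewrite !nsnd_npair; case: (odd n).
Qed.

Definition chalf : code :=
  CComp (CRec CZero (cif (CComp codd (CComp CFst CSnd)) clast (CComp CSucc clast)))
    (CPair CZero cident).

Lemma run_half p : run chalf p half.
Proof.
have rl := run_comp (@run_snd p) (@run_snd p).
apply: eq_run (run_comp (run_rec (@run_zero p)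
  (run_if (run_comp (@run_odd p) (run_comp (@run_fst p) (@run_snd p))) rl
     (run_comp (@run_succ p) rl)))
  (run_pair (@run_zero p) (@run_cident p))) _ => n.
rewrite /= nfst_npair nsnd_npair.
elim: n => //= n ->.
rewrite !nsnd_npair nfst_npair uphalf_half.
by case: (odd n); rewrite ?add0n.
Qed.

Definition cdouble : code :=
  CComp (CRec CZero (CComp CSucc (CComp CSucc clast))) (CPair CZero cident).

Lemma run_double p : run cdouble p double.
Proof.
have rl := run_comp (@run_snd p) (@run_snd p).
apply: eq_run (run_comp (run_rec (@run_zero p)
  (run_comp (@run_succ p) (run_comp (@run_succ p) rl)))
  (run_pair (@run_zero p) (@run_cident p))) _ => n.
rewrite /= nfst_npair nsnd_npair.
by elim: n => //= n ->; rewrite !nsnd_npair doubleS.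
Qed.

Definition cbfst : code := CComp COracle cdouble.
Definition cbsnd : code := CComp COracle (CComp CSucc cdouble).

Lemma run_bfst p q : run cbfst (bpair p q) p.
Proof.
apply: eq_run (run_comp (@run_oracle (bpair p q)) (@run_double _)) _ => n.
by rewrite /= /bpair odd_double doubleK.
Qed.

Lemma run_bsnd p q : run cbsnd (bpair p q) q.
Proof.
apply: eq_run (run_comp (@run_oracle (bpair p q))
  (run_comp (@run_succ _) (@run_double _))) _ => n.
by rewrite /= /bpair /= odd_double uphalf_double.
Qed.

Definition cbpair (e e' : code) : code :=
  cif codd (CComp e chalf) (CComp e' chalf).

Lemma run_bpair e e' p q r : run e p q -> run e' p r ->
  run (cbpair e e') p (bpair q r).
Proof.
move=> eq er.
apply: eq_run (run_if (@run_odd p) (run_comp eq (@run_half p))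
  (run_comp er (@run_half p))) _ => n.
by rewrite /bpair; case: (odd n).
Qed.

(** * Programs and limits *)

(* [approx p t e x] is the value of [e] at [x] with oracle [p], except that an
   unbounded search returns [t] when it finds no zero below [t]. *)
Fixpoint approx (p : baire) (t : nat) (e : code) (x : nat) : nat :=
  match e with
  | CZero => 0
  | CSucc => x.+1
  | CFst => nfst x
  | CSnd => nsnd x
  | COracle => p x
  | CPair f g => npair (approx p t f x) (approx p t g x)
  | CComp f g => approx p t f (approx p t g x)
  | CRec f g => prec (approx p t f) (approx p t g) (nfst x) (nsnd x)
  | CMu f =>
      iter t (fun v => if approx p t f (npair x v) is 0 then v else v.+1) 0
  end.

Lemma eventually_forall_lt (P : nat -> nat -> Prop) m :
  (forall j, j < m -> exists N, forall i, N <= i -> P j i) ->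
  exists N, forall j i, j < m -> N <= i -> P j i.
Proof.
elim: m => [|m IHm] evP; first by exists 0.
have [N PN] := IHm (fun j jm => evP j (ltnW jm)).
have [M PM] := evP m (ltnSn m).
exists (maxn N M) => j i; rewrite geq_max ltnS leq_eqVlt.
by move=> /orP[/eqP->|jm] /andP[Ni Mi]; [exact: PM|exact: PN].
Qed.

(** The counter advances as long as [F] is nonzero there, so it sticks at the first zero. *)
Lemma iter_search (F : nat -> nat) v t : F v = 0 ->
  (forall j, j < v -> 0 < F j) ->
  iter t (fun w => if F w is 0 then w else w.+1) 0 = minn t v.
Proof.
move=> Fv Flt; elim: t => [|t IHt]; first by rewrite min0n.
rewrite iterS IHt; have [vt|tv] := leqP v t.
  by rewrite Fv (minn_idPr (leqW vt)).
by rewrite (minn_idPl tv); case: (F t) (Flt t tv).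
Qed.

(** Induction on programs: a halting computation has finitely many subcomputations, and beyond the
    maximum of their thresholds all are correct. *)
Lemma approx_cvg P q e x v : limB P q -> ceval q e x v ->
  exists N, forall i, N <= i -> approx (bslice P i) i e x = v.
Proof.
move=> /limBP Pq.
elim: e x v => [|||||f IHf g IHg|f IHf g IHg|f IHf g IHg|f IHf] x v /=;
  try by move=> ->; exists 0.
- by move=> ->; exact: Pq.
- move=> [a [b [/IHf[N HN] /IHg[M HM] ->]]].
  exists (maxn N M) => i; rewrite geq_max => /andP[Ni Mi].
  by rewrite HN// HM.
- move=> [y /IHg[M HM] /IHf[N HN]].
  exists (maxn N M) => i; rewrite geq_max => /andP[Ni Mi].
  by rewrite HM// HN.
- move=> [s [/IHf[N HN] sS ->]].
  have [M HM] := eventually_forall_lt (fun j jx => IHg _ _ (sS j jx)).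
  exists (maxn N M) => i; rewrite geq_max => /andP[Ni Mi].
  (* The induction runs over the recursion argument while the bound [nsnd x] stays fixed, as [HM]
     only covers steps below it. *)
  have: nsnd x <= nsnd x by [].
  elim: {1 3 4}(nsnd x) => [_|m IHm mx] /=; first exact: HN.
  by rewrite IHm 1?ltnW// HM.
- move=> [/IHf[N HN] v_lt].
  have [|M HM] := @eventually_forall_lt
    (fun j i => 0 < approx (bslice P i) i f (npair x j)) v.
    move=> j /v_lt[k /IHf[M HM]]; exists M => i Mi; by rewrite HM.
  (* The cutoff [i] must also reach [v], or the search returns [i] instead. *)
  exists (maxn v (maxn N M)) => i; rewrite !geq_max => /and3P[vi Ni Mi].
  rewrite (@iter_search _ v) ?HN//; first exact/minn_idPr.
  by move=> j jv; exact: HM.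
Qed.

(* [capprox e] expects the index [i] of the approximation, paired with the
   input of [e]. *)
Fixpoint capprox (e : code) : code :=
  match e with
  | CZero => CZero
  | CSucc => CComp CSucc CSnd
  | CFst => CComp CFst CSnd
  | CSnd => CComp CSnd CSnd
  | COracle => COracle
  | CPair f g => CPair (capprox f) (capprox g)
  | CComp f g => CComp (capprox f) (CPair CFst (capprox g))
  | CRec f g =>
      CComp
        (CRec (capprox f)
           (CComp (capprox g)
              (CPair (CComp CFst CFst) (CPair (CComp CSnd CFst) CSnd))))
        (CPair (CPair CFst (CComp CFst CSnd)) (CComp CSnd CSnd))
  | CMu f =>
      CComp
        (CRec CZero
           (cif
              (CComp (capprox f)
                 (CPair (CComp CFst CFst) (CPair (CComp CSnd CFst) clast)))
              clast (CComp CSucc clast)))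
        (CPair cident CFst)
  end.

Lemma run_capprox e P : run (capprox e) P
  (fun n => approx (bslice P (nfst n)) (nfst n) e (nsnd n)).
Proof.
have rl := run_comp (@run_snd P) (@run_snd P).
have rff := run_comp (@run_fst P) (@run_fst P).
have rsf := run_comp (@run_snd P) (@run_fst P).
have rfs := run_comp (@run_fst P) (@run_snd P).
elim: e => [|||||f IHf g IHg|f IHf g IHg|f IHf g IHg|f IHf] /=.
- exact: run_zero.
- exact: run_comp (@run_succ P) (@run_snd P).
- exact: rfs.
- exact: rl.
- by move=> n /=; rewrite /bslice npair_fst_snd.
- exact: run_pair.
- apply: eq_run (run_comp IHf (run_pair (@run_fst P) IHg)) _ => n.
  by rewrite /= nfst_npair nsnd_npair.
(* The stage travels inside the recursion parameter, so the step regroups its input before calling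
   [capprox g]. *)
- apply: eq_run (run_comp (run_rec IHf
    (run_comp IHg (run_pair rff (run_pair rsf (@run_snd P)))))
    (run_pair (run_pair (@run_fst P) rfs) rl)) _ => n.
  rewrite /= nfst_npair nsnd_npair.
  elim: (nsnd (nsnd n)) => [|m /= ->]; first by rewrite /= nfst_npair nsnd_npair.
  by rewrite !(nfst_npair, nsnd_npair).
- apply: eq_run (run_comp (run_rec (@run_zero P)
    (run_if (run_comp IHf (run_pair rff (run_pair rsf rl))) rl
      (run_comp (@run_succ P) rl)))
    (run_pair (@run_cident P) (@run_fst P))) _ => n.
  rewrite /= nfst_npair nsnd_npair.
  (* Only the number of iterations is generalized; the stage inside [approx] stays fixed. *)
  move: {1 2}(nfst n) => t.
  by elim: t => //= t ->; rewrite !(nfst_npair, nsnd_npair).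
Qed.

(** Moves a computation from after a limit to before it: row [i] of [R] is the [i]-th approximation
    of [e] on row [i] of [P]. *)
Lemma run_limB e P q r : limB P q -> run e q r ->
  exists2 R, run (capprox e) P R & limB R r.
Proof.
move=> Pq eqr; eexists; first exact: run_capprox.
apply/limBP => j; have [N HN] := approx_cvg Pq (eqr j).
by exists N => i Ni /=; rewrite nfst_npair nsnd_npair HN.
Qed.

(** Pairs each row of the sequence computed by [e] with the oracle itself. The constant component
    survives the limit, so postprocessing for [limB] can still read the original input. *)
Definition cbpair_seq (e : code) : code :=
  cif (CComp codd CSnd)
    (CComp COracle (CComp chalf CSnd))
    (CComp e (CPair CFst (CComp chalf CSnd))).

Lemma run_bpair_seq e p k q : run e p k -> limB k q ->
  exists2 R, run (cbpair_seq e) p R & limB R (bpair p q).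
Proof.
move=> ek /limBP kq.
have rh := run_comp (@run_half p) (@run_snd p).
eexists.
  apply: run_if (run_comp (@run_odd p) (@run_snd p)) _ _.
    exact: run_comp (@run_oracle p) rh.
  exact: run_comp ek (run_pair (@run_fst p) rh).
apply/limBP => j; have [N HN] := kq j./2.
exists N => i Ni /=; rewrite nfst_npair nsnd_npair /bpair.
by case: (odd j) => //=; exact: HN.
Qed.

(** * Reductions without realizers *)

Section Realizers.
Variables (X Y Z W : repSpace) (f : mfun X Y) (g : mfun Z W).

(** Values are selected by choice, and the graph is then cut down to names of points in [mdom g].
    This minimal domain lets a successful run of [G] certify that its input is such a name. *)
Lemma realizer_in (R : baire -> set baire) :
  (forall p z, repr p z -> mdom g z ->
     exists q w, [/\ R p q, repr q w & g z w]) ->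
  exists2 G : bfun, realizer G g &
    forall p q, G p q -> R p q /\ exists2 z, repr p z & mdom g z.
Proof.
move=> Rg.
have /choice[c cP] : forall p, exists q, forall z, repr p z -> mdom g z ->
    exists w, [/\ R p q, repr q w & g z w].
  move=> p; have [[z pz gz]|nz] := pselect (exists2 z, repr p z & mdom g z).
    have [q [w [Rpq qw gw]]] := Rg p z pz gz.
    by exists q => z' /(repr_fun pz) <- _; exists w.
  by exists p => z pz gz; case: nz; exists z.
exists (fun p => [set q | q = c p /\ exists2 z, repr p z & mdom g z]).
  split; first by move=> p q r [-> _] [->].
  move=> p z pz gz; have [w [_ qw gw]] := cP p z pz gz.
  by exists (c p), w; split=> //; split=> //; exists z.
move=> p _ [-> [z pz gz]]; split; last by exists z.
by have [w []] := cP p z pz gz.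
Qed.

Lemma repr_choice z : mdom g z -> exists q w, repr q w /\ g z w.
Proof. by move=> [w gw]; have [q qw] := repr_surj w; exists q, w. Qed.

(** The parameter [h] is what the postprocessing sees: [bpair] for Weihrauch reducibility,
    [fun=> id] for the strong version. *)
Definition reduces (h : baire -> baire -> baire) (H K : bfun) : Prop :=
  forall p x, repr p x -> mdom f x ->
    exists k z, [/\ K p k, repr k z, mdom g z &
      forall r w, repr r w -> g z w ->
        exists s y, [/\ H (h p r) s, repr s y & f x y]].

Lemma reducesP (h : baire -> baire -> baire) (H K : bfun) :
  is_fun H -> is_fun K ->
  (forall G, realizer G g ->
     @realizer X Y
       (fun p => [set s | exists k r, [/\ K p k, G k r & H (h p r) s]]) f) <->
  reduces h H K.
Proof.
move=> Hfun Kfun; split=> [red p x px fx|red G [Gfun Gg]].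
  (* A first test realizer of minimal domain shows that [K] sends [p] to a name of a point in
     [mdom g]. *)
  have [|G0 G0g G0T] := @realizer_in (fun=> setT).
    by move=> k z kz /repr_choice[q [w [qw gw]]]; exists q, w.
  have [_ /(_ p x px fx)[_ [_ [[k [r [pk kr _]]] _ _]]]] := red _ G0g.
  have [_ [z kz gz]] := G0T _ _ kr.
  exists k, z; split=> // {G0 G0g G0T kr}r w rw gw.
  (* A second one is forced to answer [r] at [k], which exposes [H] on that particular answer. *)
  have [|G Gg GR] := @realizer_in (fun k' q => k' = k -> q = r).
    move=> k' z' k'z' gz'; have [E|ne] := pselect (k' = k).
      exists r, w; split=> //; rewrite E in k'z'.
      by rewrite (repr_fun k'z' kz).
    by have [q [w' [qw' gw']]] := repr_choice gz'; exists q, w'; split=> // /ne.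
  have [_ /(_ p x px fx)[s [y [[k' [r' [pk' kr' Hs]]] sy fy]]]] := red _ Gg.
  move: kr'; rewrite (Kfun _ _ _ pk' pk) => /GR[/(_ erefl) r'E _].
  by exists s, y; split=> //; rewrite -r'E.
split.
  move=> p s t [k [r [pk kr Hs]]] [k' [r' [pk' kr' Ht]]].
  move: kr' Ht; rewrite -(Kfun _ _ _ pk pk') => /(Gfun _ _ _ kr) <-.
  exact: Hfun.
move=> p x px fx; have [k [z [pk kz gz post]]] := red p x px fx.
have [r [w [kr rw gw]]] := Gg k z kz gz.
have [s [y [Hs sy fy]]] := post r w rw gw.
by exists s, y; split=> //; exists k, r.
Qed.

(** Allows passing from a computable function to the possibly larger graph of its program. *)
Lemma reduces_sub h (H K H' K' : bfun) :
  (forall p q, H p q -> H' p q) -> (forall p q, K p q -> K' p q) ->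
  reduces h H K -> reduces h H' K'.
Proof.
move=> HH' KK' red p x px fx; have [k [z [pk kz gz post]]] := red p x px fx.
exists k, z; split=> //; first exact: KK'.
move=> r w rw gw; have [s [y [Hs sy fy]]] := post r w rw gw.
by exists s, y; split=> //; exact: HH'.
Qed.

Lemma mcomp_fun (A B C : Type) (G : mfun B C) (K : mfun A B) : is_fun K ->
  mcomp G K = fun p => [set q | exists2 k, K p k & G k q].
Proof.
move=> Kfun; apply: funext => p; apply/seteqP; split=> q; first by case.
move=> [k pk kq]; split; last by exists k.
by move=> k' /(Kfun _ _ _ pk) <-; exists q.
Qed.

Lemma leWP : leW f g <->
  exists eH eK, reduces bpair (run eH) (run eK).
Proof.
have leE (H K G : bfun) : is_fun K ->
    (fun p => [set r | exists2 q, mcomp G K p q & H (bpair p q) r]) =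
    (fun p => [set s | exists k r, [/\ K p k, G k r & H (bpair p r) s]]).
  move=> Kfun; rewrite (mcomp_fun G Kfun).
  apply: funext => p; apply/seteqP; split=> s /=.
    by move=> [q [k pk kq] Hs]; exists k, q.
  by move=> [k [q [pk kq Hs]]]; exists q => //; exists k.
split=> [[H [K [[Hfun [eH HeH]] [Kfun [eK KeK]] red]]]|[eH [eK red]]].
  exists eH, eK; apply: reduces_sub HeH KeK _; apply/(reducesP _ Hfun Kfun).
  by move=> G Gg; rewrite -leE//; exact: red.
exists (run eH), (run eK); split; try exact: run_computable.
move=> G Gg; rewrite leE; last exact: run_fun.
by move: G Gg; apply/reducesP => //; exact: run_fun.
Qed.

Lemma lesWP : lesW f g <->
  exists eH eK, reduces (fun=> id) (run eH) (run eK).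
Proof.
have leE (H K G : bfun) : is_fun K -> is_fun G -> mcomp H (mcomp G K) =
    (fun p => [set s | exists k r, [/\ K p k, G k r & H r s]]).
  move=> Kfun Gfun; rewrite mcomp_fun (mcomp_fun G Kfun)//.
    apply: funext => p; apply/seteqP; split=> s /=.
      by move=> [q [k pk kq] Hs]; exists k, q.
    by move=> [k [q [pk kq Hs]]]; exists q => //; exists k.
  move=> p q r [k pk kq] [k' /(Kfun _ _ _ pk) <-]; exact: Gfun.
split=> [[H [K [[Hfun [eH HeH]] [Kfun [eK KeK]] red]]]|[eH [eK red]]].
  exists eH, eK; apply: reduces_sub HeH KeK _; apply/(reducesP _ Hfun Kfun).
  by move=> G Gg; rewrite -leE//; [exact: red|exact: Gg.1].
exists (run eH), (run eK); split; try exact: run_computable.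
move=> G Gg; rewrite leE; [|exact: run_fun|exact: Gg.1].
by move: G Gg; apply/reducesP => //; exact: run_fun.
Qed.

End Realizers.

(** * Reductions to the derivative and factorizations through [limB] *)

Lemma jump_reprP (Z : repSpace) (k : baire) (z : Z) :
  jump_repr k z <-> exists2 q, limB k q & repr q z.
Proof. by rewrite /jump_repr (mcomp_fun _ limB_fun). Qed.

(** The intermediate point is [bpair p q], with [p] a name of [x] and [q] the limit of the
    preprocessed [p]. Since [p] determines [x], [g0] can return exactly the values of [f] at [x],
    which gives an equality. *)
Lemma leW_deriv_factor (X Y Z W : repSpace) (f : mfun X Y) (g : mfun Z W) :
  leW f (deriv g) ->
  exists (V : repSpace) (g0 : mfun V Y) (l0 : mfun X V),
    [/\ f = mcomp g0 l0, leW g0 g & leW l0 limB].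
Proof.
move=> /leWP[eH [eK red]].
pose N p (x : X) u := exists k q, [/\ repr p x, run eK p k, limB k q & u = bpair p q].
pose l0 : mfun X baireS := fun x => [set u | mdom f x /\ exists p, N p x u].
pose g0 : mfun baireS Y :=
  fun u => [set y | exists p x, N p x u /\ f x y].
exists baireS, g0, l0; split.
- apply: funext => x; apply/seteqP; split=> y.
    move=> fy; have fx : mdom f x by exists y.
    split.
      move=> u [_ [p Np]]; exists y, p, x; by split.
    have [p px] := repr_surj x.
    have [k [z [pk /jump_reprP[q kq qz] _ _]]] := red p x px fx.
    have Np : N p x (bpair p q) by exists k, q.
    by exists (bpair p q); [split=> //; exists p|exists p, x].
  move=> [_ [u [fx [p [k [q [px pk kq ->]]]]]]].
  move=> [p' [x' [[k' [q' [p'x' _ _ /bpair_inj[pp' _]]]] fy]]].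
  by move: p'x'; rewrite -pp' => /(repr_fun px) ->.
- apply/leWP; exists (csubst (cbpair (csubst cbfst cbfst) cbsnd) eH), cbsnd.
  move=> u _ -> [y [p [x [[k [q [px pk kq ->]]] fy]]]].
  have fx : mdom f x by exists y.
  have [k' [z [pk' /jump_reprP[q' kq' qz] gz post]]] := red p x px fx.
  move: kq'; rewrite -(run_fun pk pk') => /(limB_fun kq) qq'.
  exists q, z; split=> //; first exact: run_bsnd.
    by rewrite qq'.
  move=> r w rw gw; have [s [y' [Hs sy' fy']]] := post r w rw gw.
  exists s, y'; split=> //; last by exists p, x; split=> //; exists k, q.
  apply: run_csubst Hs; apply: run_bpair (@run_bsnd _ _).
  exact: run_csubst (@run_bfst _ _) (@run_bfst _ _).
(* The postprocessing oracle [bpair p w] already is a point of [l0 x]. *)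
- apply/leWP; exists COracle, eK => p x px [_ [fx _]].
  have [k [z [pk /jump_reprP[q kq qz] _ _]]] := red p x px fx.
  exists k, k; split=> //; first by exists q.
  move=> w _ -> kw; exists (bpair p w), (bpair p w); split=> //.
  by split=> //; exists p, k, w.
Qed.

Lemma factor_leW_deriv (X Y Z W V : repSpace) (f : mfun X Y) (g : mfun Z W)
    (g0 : mfun V Y) (l0 : mfun X V) :
  cylinder g -> f = mcomp g0 l0 -> leW g0 g -> leW l0 limB ->
  leW f (deriv g).
Proof.
move=> [_ /lesWP[eH4 [eK4 red4]]] -> /leWP[eH2 [eK2 red2]] /leWP[eH3 [eK3 red3]].
apply/leWP.
exists (csubst (csubst cbsnd eH4) eH2),
  (csubst (cbpair_seq eK3) (capprox (csubst eH3 (csubst (cbpair COracle eK2) eK4)))).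
move=> p x px [y0 [l0g0 [v0 l0v0 _]]].
have l0x : mdom l0 x by exists v0.
have [k [_ [pk -> [q kq] post3]]] := red3 p x px l0x.
have [q0 [v [pq0 q0v l0v]]] := post3 q q erefl kq.
have [r [z [q0r rz gz post2]]] := red2 q0 v q0v (l0g0 _ l0v).
(* Postprocessing for [g0] needs [q0], which is only available after the limit. The cylinder
   reduction takes [q0] along as the identity component. *)
have q0rz : repr (r := prodS baireS Z) (bpair q0 r) (q0, z).
  by exists q0, r; split.
have [|u [z' [ru uz' gz' post4]]] := red4 _ _ q0rz.
  by have [w gw] := gz; exists (q0, w); split.
have [R pR RP] := run_bpair_seq pk kq.
(* Everything done after the limit, namely [eH3], [eK2] with its input kept, and [eK4], moves in
   front of it. *)
have [U RU Uu] := run_limB RP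
  (run_csubst pq0 (run_csubst (run_bpair (@run_oracle q0) q0r) ru)).
exists U, z'; split=> //; first exact: run_csubst pR RU.
  by apply/jump_reprP; exists u.
move=> t w' tw' gw'.
have [c [[b w] [Ht [b' [t' [/= cE b'E t'w]]] [/= bE gw]]]] := post4 t w' tw' gw'.
have [s [y [Hs sy g0y]]] := post2 t' w t'w gw.
exists s, y; split=> //; last by split=> //; exists v.
(* The identity component of the answer is [q0] again, so [eH4] outputs precisely the oracle that
   [eH2] expects. *)
apply: run_csubst (run_csubst (@run_bsnd p t) Ht) _.
by rewrite cE -b'E bE.
Qed.

(** The intermediate point is now the limit [q] alone, so [g0] cannot refer to [x]: its values are
    whatever [eH] names from answers of [g]. These may be fewer than the values of [f], hence
    [mweaker]. *)
Lemma lesW_deriv_factor (X Y Z W : repSpace) (f : mfun X Y) (g : mfun Z W) :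
  lesW f (deriv g) ->
  exists (V : repSpace) (g0 : mfun V Y) (l0 : mfun X V),
    [/\ mweaker f (mcomp g0 l0), lesW g0 g & lesW l0 limB].
Proof.
move=> /lesWP[eH [eK red]].
pose l0 : mfun X baireS := fun x => [set q | mdom f x /\
  exists p k, [/\ repr p x, run eK p k & limB k q]].
(* The universal clause confines the domain to those [q] for which [eH] succeeds on every answer, as
   the reduction to [g] requires. *)
pose g0 : mfun baireS Y := fun q => [set y | exists z, [/\ repr q z, mdom g z,
  forall r w, repr r w -> g z w ->
    exists s (y' : Y), run eH r s /\ repr s y' &
  exists r w s, [/\ repr r w, g z w, run eH r s & repr s y]]].
have red_l0 x q : l0 x q -> exists z, [/\ repr q z, mdom g z &
    forall r w, repr r w -> g z w ->
      exists s y, [/\ run eH r s, repr s y & f x y]].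
  move=> [fx [p [k [px pk kq]]]].
  have [k' [z [pk' /jump_reprP[q' kq' qz] gz post]]] := red p x px fx.
  exists z; split=> //.
  by move: kq'; rewrite -(run_fun pk pk') => /(limB_fun kq) ->.
have l0_dom x : l0 x `<=` mdom g0.
  move=> q /red_l0[z [qz gz post]].
  have [r [w [rw gw]]] := repr_choice gz.
  have [s [y [Hs sy _]]] := post r w rw gw.
  exists y, z; split=> //; last by exists r, w, s.
  by move=> r' w' r'w' gw'; have [s' [y' []]] := post r' w' r'w' gw'; exists s', y'.
exists baireS, g0, l0; split.
- split=> [x fx|x fx y [_ [q /red_l0[z [qz _ post]]]]].
    have [p px] := repr_surj x.
    have [k [z [pk /jump_reprP[q kq _] _ _]]] := red p x px fx.
    have l0q : l0 x q by split=> //; exists p, k.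
    by have [y g0y] := l0_dom _ _ l0q; exists y; split=> //; exists q.
  move=> [z' [/(repr_fun qz) <- _ _ [r [w [s [rw gw Hs sy]]]]]].
  have [s' [y' [Hs' sy' fy']]] := post r w rw gw.
  by move: sy'; rewrite -(run_fun Hs Hs') => /(repr_fun sy) ->.
- apply/lesWP; exists eH, COracle => q _ -> [_ [z [qz gz post _]]].
  exists q, z; split=> // r w rw gw.
  have [s [y [Hs sy]]] := post r w rw gw.
  by exists s, y; split=> //; exists z; split=> //; exists r, w, s.
- apply/lesWP; exists COracle, eK => p x px [_ [fx _]].
  have [k [z [pk /jump_reprP[q kq qz] _ _]]] := red p x px fx.
  exists k, k; split=> //; first by exists q.
  move=> w _ -> kw; exists w, w; split=> //.
  by split=> //; exists p, k.
Qed.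

Lemma mweaker_lesW (X Y : repSpace) (f1 f2 : mfun X Y) :
  mweaker f1 f2 -> lesW f1 f2.
Proof.
move=> [dom12 sub]; apply/lesWP; exists COracle, COracle => p x px fx.
exists p, x; split=> //; first exact: dom12.
by move=> r w rw f2w; exists r, w; split=> //; exact: sub.
Qed.

(** No postprocessing reads an original input, so the programs simply chain, with [eH3] and [eK2]
    moved before the limit, and no cylinder is required. *)
Lemma factor_lesW_deriv (X Y Z W A B C : repSpace) (f : mfun X Y)
    (g : mfun Z W) (g0 : mfun B C) (l0 : mfun A B) :
  lesW f (mcomp g0 l0) -> lesW g0 g -> lesW l0 limB -> lesW f (deriv g).
Proof.
move=> /lesWP[eH1 [eK1 red1]] /lesWP[eH2 [eK2 red2]] /lesWP[eH3 [eK3 red3]].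
apply/lesWP.
exists (csubst eH2 eH1), (csubst (csubst eK1 eK3) (capprox (csubst eH3 eK2))).
move=> p x px fx.
have [a [x1 [pa a_x1 [c0 [l0g0 [b0 l0b0 _]]] post1]]] := red1 p x px fx.
have l0_x1 : mdom l0 x1 by exists b0.
have [k [_ [ak -> [q kq] post3]]] := red3 a x1 a_x1 l0_x1.
have [q0 [b [qq0 q0b l0b]]] := post3 q q erefl kq.
have [r [z [q0r rz gz post2]]] := red2 q0 b q0b (l0g0 _ l0b).
have [R kR Rr] := run_limB kq (run_csubst qq0 q0r).
exists R, z; split=> //.
- exact: run_csubst (run_csubst pa ak) kR.
- by apply/jump_reprP; exists r.
move=> t w tw gw; have [s [c [Hs sc g0c]]] := post2 t w tw gw.
have [|s' [y [Hs' s'y fy]]] := post1 s c sc; first by split=> //; exists b.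
by exists s', y; split=> //; exact: run_csubst Hs Hs'.
Qed.

Theorem theorem5p14 (X Y Z W : repSpace) (f : mfun X Y) (g : mfun Z W) :
  (cylinder g ->
     (leW f (deriv g) <->
      exists (V : repSpace) (g0 : mfun V Y) (l0 : mfun X V),
        [/\ f = mcomp g0 l0, leW g0 g & leW l0 limB]))
  /\
  (lesW f (deriv g) <->
   exists (V : repSpace) (g0 : mfun V Y) (l0 : mfun X V),
     [/\ mweaker f (mcomp g0 l0), lesW g0 g & lesW l0 limB])
  /\
  (lesW f (deriv g) <->
   exists (A B C : repSpace) (g0 : mfun B C) (l0 : mfun A B),
     [/\ lesW f (mcomp g0 l0), lesW g0 g & lesW l0 limB]).
Proof.
split=> [gcyl|]; first split.
- exact: leW_deriv_factor.
- by move=> [V [g0 [l0 [fE g0g l0lim]]]]; exact: factor_leW_deriv fE g0g l0lim.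
split; split.
- exact: lesW_deriv_factor.
- move=> [V [g0 [l0 [/mweaker_lesW fE g0g l0lim]]]].
  exact: factor_lesW_deriv fE g0g l0lim.
- move=> /lesW_deriv_factor[V [g0 [l0 [/mweaker_lesW fE g0g l0lim]]]].
  by exists X, V, Y, g0, l0.
- move=> [A [B [C [g0 [l0 [fE g0g l0lim]]]]]].
  exact: factor_lesW_deriv fE g0g l0lim.
Qed.
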